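(* Let $\mathcal{C}\subset\mathbb{R}^p$ be a closed bounded convex set with Euclidean diameter $\|\mathcal{C}\|_2$, let $\ell(\cdot;d):\mathcal{C}\to\mathbb{R}$ be convex and $L$-Lipschitz for every $d$ in the data universe, and let $\epsilon>0$. The algorithm $\mathcal{A}_{\sf exp-samp}$ that, on input a data set $\mathcal{D}=\{d_1,\dots,d_n\}$, outputs a point $\theta^{priv}\in\mathcal{C}$ sampled from the distribution on $\mathcal{C}$ with density proportional to $\exp\left(-\frac{\epsilon}{2L\|\mathcal{C}\|_2}\mathcal{L}(\theta;\mathcal{D})\right)$, where $\mathcal{L}(\theta;\mathcal{D})=\sum_{i=1}^n\ell(\theta;d_i)$, is $\epsilon$-differentially private.
   Context: Densities are with respect to $p$-dimensional Lebesgue measure on $\mathcal{C}$; $\mathcal{C}$ has nonempty interior, so that the distribution is well defined. Lipschitz is with respect to the Euclidean norm. Differential privacy: two data sets of size $n$ are neighbors if they differ in one entry. A randomized algorithm $\mathcal{A}$ is $\epsilon$-differentially private if for all neighboring $\mathcal{D},\mathcal{D}'$ and all events $S$ in the output space, $\Pr(\mathcal{A}(\mathcal{D})\in S)\le e^{\epsilon}\Pr(\mathcal{A}(\mathcal{D}')\in S)$. *)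

(* Defs.v *)
From HB Require Import structures.
From mathcomp Require Import all_boot all_order all_algebra.
From mathcomp Require Import all_classical all_reals all_analysis.
Set Implicit Arguments.
Unset Strict Implicit.
Unset Printing Implicit Defensive.
Import Order.TTheory GRing.Theory Num.Theory.
Import numFieldNormedType.Exports.
Local Open Scope classical_set_scope.
Local Open Scope ring_scope.

(* The sigma-algebra on R^n is generated by the coordinate maps, as the library
   does for tuples; it is the Borel sigma-algebra. *)
Definition measure_rV_display : measure_display -> measure_display.
Proof. exact. Qed.

Section measurable_rV.
Context d (T : sigmaRingType d) (n : nat).

Definition rV_coord (i : 'I_n) (x : 'rV[T]_n) : T := x ord0 i.

Let rV_set0 : g_sigma_preimage rV_coord set0.
Proof. exact: sigma_algebra0. Qed.

Let rV_setC A : g_sigma_preimage rV_coord A -> g_sigma_preimage rV_coord (~` A).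
Proof. exact: sigma_algebraC. Qed.

Let rV_bigcup (F : _^nat) : (forall i, g_sigma_preimage rV_coord (F i)) ->
  g_sigma_preimage rV_coord (\bigcup_i (F i)).
Proof. exact: sigma_algebra_bigcup. Qed.

HB.instance Definition _ := @isMeasurable.Build (measure_rV_display d)
  'rV[T]_n (g_sigma_preimage rV_coord) rV_set0 rV_setC rV_bigcup.

End measurable_rV.

Section measurable_rV_lemmas.
Context d d1 (T : measurableType d) (T1 : measurableType d1) (n : nat).

Lemma measurable_rV_coord (i : 'I_n) :
  measurable_fun [set: 'rV[T]_n] (rV_coord i).
Proof.
move=> _ Y mY; rewrite setTI; apply: sub_sigma_algebra => /=.
rewrite -bigcup_seq/=; exists i => /=; first by rewrite mem_index_enum.
by exists Y => //; rewrite setTI.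
Qed.

Lemma measurable_fun_rV (f : T1 -> 'rV[T]_n) :
  (forall i, measurable_fun [set: T1] (rV_coord i \o f)) ->
  measurable_fun [set: T1] f.
Proof.
move=> mf _ A mA; rewrite setTI.
suff: g_sigma_preimage (@rV_coord d T n) `<=` [set B | measurable (f @^-1` B)].
  exact.
apply: smallest_sub.
  split=> /=.
  - by rewrite preimage_set0.
  - by move=> B mB; rewrite setTD preimage_setC; exact: measurableC.
  - by move=> F mF; rewrite preimage_bigcup; exact: bigcup_measurable.
move=> B; rewrite -bigcup_seq => -[i _ [Y mY <-]] /=.
by rewrite setTI -comp_preimage -[X in measurable X]setTI; exact: mf.
Qed.

End measurable_rV_lemmas.

Section lebesgue_rV.
Context (R : realType).

Definition rV_cons n (z : R * 'rV[R]_n) : 'rV[R]_n.+1 := row_mx z.1%:M z.2.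

Lemma measurable_rV_cons n : measurable_fun [set: R * 'rV[R]_n] (@rV_cons n).
Proof.
apply: measurable_fun_rV => i; case: (split_ordP (i : 'I_(1 + n))) => j ->.
- rewrite (_ : _ \o _ = fst); first exact: measurable_fst.
  by apply/funext => z; rewrite /rV_coord /rV_cons /comp (@row_mxEl _ 1 1 n) mxE (ord1 j) (ord1 ord0) eqxx mulr1n.
- rewrite (_ : _ \o _ = rV_coord j \o snd); last first.
    by apply/funext => z; rewrite /rV_coord /rV_cons /comp (@row_mxEr _ 1 1 n).
  by apply: measurableT_comp; [exact: measurable_rV_coord|exact: measurable_snd].
Qed.

Section step.
Context n (m : {sigma_finite_measure set 'rV[R]_n -> \bar R}).

Definition lebesgue_rV_step : set 'rV[R]_n.+1 -> \bar R :=
  pushforward (lebesgue_measure \x m)%E (@rV_cons n).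

Let step0 : lebesgue_rV_step set0 = 0%E.
Proof. by rewrite /lebesgue_rV_step /pushforward preimage_set0 measure0. Qed.

Let step_ge0 A : (0 <= lebesgue_rV_step A)%E.
Proof. exact: (measure_ge0 (lebesgue_measure \x m)%E). Qed.

Let step_sigma_additive : semi_sigma_additive lebesgue_rV_step.
Proof.
move=> F mF tF mUF; rewrite /lebesgue_rV_step /pushforward preimage_bigcup.
apply: (@measure_semi_sigma_additive _ _ _ (lebesgue_measure \x m)%E).
- by move=> k; rewrite -[X in measurable X]setTI; exact: measurable_rV_cons.
- apply/trivIsetP => /= i j _ _ ij; rewrite -preimage_setI.
  by move/trivIsetP : tF => /(_ _ _ _ _ ij) ->//; rewrite preimage_set0.
- by rewrite -preimage_bigcup -[X in measurable X]setTI;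
    exact: measurable_rV_cons.
Qed.

HB.instance Definition _ := isMeasure.Build _ _ _ lebesgue_rV_step
  step0 step_ge0 step_sigma_additive.

Let step_sigma_finite : sigma_finite setT lebesgue_rV_step.
Proof.
have /sigma_finiteP[F [FT ndF mF]] := sigma_finiteT (@lebesgue_measure R).
have /sigma_finiteP[G [GT ndG mG]] := sigma_finiteT m.
pose uncons (x : 'rV[R]_n.+1) : R * 'rV[R]_n :=
  (x ord0 ord0, \row_j x ord0 (lift ord0 j)).
have muncons : measurable_fun setT uncons.
  apply: measurable_fun_pair; first exact: (measurable_rV_coord ord0).
  apply: measurable_fun_rV => i.
  rewrite (_ : _ \o _ = rV_coord (lift ord0 i)).
    exact: measurable_rV_coord.
  by apply/funext => x; rewrite /rV_coord /= mxE.
have consK z : uncons (rV_cons z) = z.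
  case: z => a v; rewrite /uncons /rV_cons /=; congr pair.
    rewrite (_ : ord0 = lshift n ord0 :> 'I_(1 + n)); last exact: val_inj.
    by rewrite (@row_mxEl _ 1 1 n) mxE mulr1n.
  apply/rowP => j; rewrite mxE.
  rewrite (_ : lift ord0 j = rshift 1 j :> 'I_(1 + n)); last exact: val_inj.
  by rewrite (@row_mxEr _ 1 1 n).
exists (fun k => uncons @^-1` (F k `*` G k)).
  apply/esym; rewrite -subTset => x _.
  have : [set: R] (x ord0 ord0) by []; rewrite FT => -[i _ Fi].
  have : [set: 'rV[R]_n] (uncons x).2 by []; rewrite GT => -[j _ Gj].
  exists (maxn i j) => //; split => /=.
  - by move: Fi; exact/subsetPset/ndF/leq_maxl.
  - by move: Gj; exact/subsetPset/ndG/leq_maxr.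
move=> k; have [mFk Fkoo] := mF k; have [mGk Gkoo] := mG k; split.
  by rewrite -[X in measurable X]setTI; apply: muncons => //; exact: measurableX.
rewrite /lebesgue_rV_step /pushforward -comp_preimage.
rewrite (_ : uncons \o _ = id); last by apply/funext => z; rewrite /= consK.
by rewrite preimage_id product_measure1E// lte_mul_pinfty// ge0_fin_numE.
Qed.

HB.instance Definition _ := Measure_isSigmaFinite.Build _ _ _ lebesgue_rV_step
  step_sigma_finite.

End step.

(* Lebesgue measure on R^n: the n-fold product of Lebesgue measure on R, with
   R^n.+1 identified with R x R^n; R^0 carries the point mass. *)
Fixpoint lebesgue_rV n : {sigma_finite_measure set 'rV[R]_n -> \bar R} :=
  if n is n'.+1 return {sigma_finite_measure set 'rV[R]_n -> \bar R}
  then lebesgue_rV_step (lebesgue_rV n') else dirac (0 : 'rV[R]_0).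

End lebesgue_rV.

Section euclidean.
Context (R : realType) (p : nat).
Implicit Types (x y : 'rV[R]_p) (C : set 'rV[R]_p).

(* The library norm on 'rV[R]_p is the sup norm. *)
Definition norm2 x : R := Num.sqrt (\sum_(i < p) x ord0 i ^+ 2).

Definition diam2 C : R := sup [set norm2 (x - y) | x in C & y in C].

Definition lipschitz2 C (L : R) (f : 'rV[R]_p -> R) : Prop :=
  forall x y, C x -> C y -> `|f x - f y| <= L * norm2 (x - y).

End euclidean.

Section differential_privacy.
Context (R : realType) (X : Type) (n : nat).

Definition neighbors (D D' : n.-tuple X) : Prop :=
  exists i : 'I_n, tnth D i <> tnth D' i /\
    forall j : 'I_n, j != i -> tnth D j = tnth D' j.

(* A randomized algorithm is identified with the map sending each data set to
   the law of its output. *)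
Definition differentially_private d (T : measurableType d) (eps : R)
    (A : n.-tuple X -> probability T R) : Prop :=
  forall D D', neighbors D D' -> forall S : set T, measurable S ->
    (A D S <= (expR eps)%:E * A D' S)%E.

End differential_privacy.

Section exponential_sampling.
Context (R : realType) (p n : nat) (X : Type).
Implicit Types (C : set 'rV[R]_p) (l : 'rV[R]_p -> X -> R).

(* P is the law on C whose Lebesgue density is proportional to f; in particular
   P gives no mass to the complement of C. *)
Definition density_proportional_to C (f : 'rV[R]_p -> R)
    (P : probability 'rV[R]_p R) : Prop :=
  exists2 c : R, 0 < c & forall S : set 'rV[R]_p, measurable S ->
    P S = (\int[lebesgue_rV R p]_(x in S `&` C) (c * f x)%:E)%E.

Definition empirical_loss l (theta : 'rV[R]_p) (D : n.-tuple X) : R :=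
  \sum_(i < n) l theta (tnth D i).

Definition is_exp_samp C l (L eps : R)
    (A : n.-tuple X -> probability 'rV[R]_p R) : Prop :=
  forall D, density_proportional_to C
    (fun theta =>
      expR (- (eps / (2 * L * diam2 C)) * empirical_loss l theta D)) (A D).

End exponential_sampling.

(* Main.v *)
(* Let f_D denote the unnormalized density.  Changing one entry of D changes the
   loss by theta |-> l theta d - l theta d', which may be arbitrarily large but
   whose oscillation on C is at most 2 L diam(C).  Hence the ratio f_D / f_D'
   varies by a factor at most e^eps over C.  Since both normalized densities
   integrate to 1, their ratio is somewhere at most 1, hence everywhere at most
   e^eps: bounding oscillations loses no second factor to the normalization. *)
Require Import Defs.
From HB Require Import structures.
From mathcomp Require Import all_boot all_order all_algebra.
From mathcomp Require Import all_classical all_reals all_analysis.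
From mathcomp Require Import measurable_realfun ring lra.
Set Implicit Arguments.
Unset Strict Implicit.
Unset Printing Implicit Defensive.
Import Order.TTheory GRing.Theory Num.Theory.
Import numFieldNormedType.Exports.
Local Open Scope classical_set_scope.
Local Open Scope ring_scope.

(** * Measurability of topological sets and continuous functions on row vectors *)

Section rV_measurability.
Context (R : realType) (n : nat).
Implicit Types (x y : 'rV[R]_n) (e : R).

(** Positivity of [e] matters when [n = 0]: the intersection is then the whole space, while a ball
    of nonpositive radius is empty. *)
Lemma ball_rVE x e : 0 < e ->
  ball x e = \bigcap_i (rV_coord i @^-1` ball (x ord0 i) e).
Proof.
move=> e0; apply/seteqP; split => y.
  by case=> _ xy i _; exact: xy.
by move=> xy; split => // i j; rewrite (ord1 i); exact: xy.
Qed.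

Lemma measurable_ball_rV x e : measurable (ball x e : set 'rV[R]_n).
Proof.
have [e0|e0] := ltP 0 e; last first.
  suff -> : ball x e = set0 by [].
  by apply/seteqP; split => // y [+ _]; rewrite ltNge e0.
rewrite ball_rVE//; apply: fin_bigcap_measurable => // i _.
rewrite -[X in measurable X]setTI.
by apply: (measurable_rV_coord i measurableT); exact: measurable_ball.
Qed.

(** An open set is the union of the balls it contains that have a rational centre and radius
    [k.+1%:R^-1], and there are only countably many of these. *)
Lemma open_measurable_rV (U : set 'rV[R]_n) : open U -> measurable U.
Proof.
move=> oU.
pose B (z : 'rV[rat]_n * nat) : set 'rV[R]_n :=
  ball (map_mx ratr z.1 : 'rV[R]_n) z.2.+1%:R^-1.
have -> : U = \bigcup_z (if `[< B z `<=` U >] then B z else set0).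
  apply/seteqP; split => [x Ux|x [z _]]; last first.
    by case: ifPn => // /asboolP; exact.
  have /nbhs_ballP[r/= r0 rU] : nbhs x U by exact: open_nbhs_nbhs.
  (* The small ball is centred near [x], not at [x]; with radius below [r / 2], the triangle
     inequality keeps it inside [ball x r]. *)
  have r20 : 0 < r / 2 by rewrite divr_gt0.
  have [k _ /(_ _ (leqnn k)) /= kr] := near_infty_natSinv_lt (PosNum r20).
  have k0 : 0 < k.+1%:R^-1 :> R by rewrite invr_gt0.
  have qP (i : 'I_n) : exists q : rat, ball (x ord0 i) k.+1%:R^-1 (ratr q).
    have /rat_in_itvoo[q] : x ord0 i - k.+1%:R^-1 < x ord0 i + k.+1%:R^-1.
      by rewrite ltrBlDr -addrA ltrDl addr_gt0.
    by move=> xq; exists q; rewrite ball_itv.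
  have [q xq] := choice qP.
  have Bqx : B (\row_i q i, k) x.
    by split => // i j; rewrite !mxE (ord1 i); exact/ball_sym.
  exists (\row_i q i, k) => //; rewrite ifT//.
  apply/asboolP => y Bqy; apply: rU; rewrite (splitr r).
  by apply: (@ball_triangle _ _ (map_mx ratr (\row_i q i) : 'rV[R]_n));
    [apply/ball_sym|]; apply: le_ball (ltW kr) _ _.
apply: countable_bigcupT_measurable => [|z]; first exact: countableP.
by case: ifPn => // _; exact: measurable_ball_rV.
Qed.

Lemma closed_measurable_rV (F : set 'rV[R]_n) : closed F -> measurable F.
Proof.
by move=> /closed_openC /open_measurable_rV /measurableC; rewrite setCK.
Qed.

(** Open intervals generate the Borel sets of the line, and the preimage of one is the trace on [D]
    of an open set. *)
Lemma within_continuous_measurable_rV (D : set 'rV[R]_n) (f : 'rV[R]_n -> R) :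
  measurable D -> {within D, continuous f} -> measurable_fun D f.
Proof.
move=> mD /continuousP cf; apply: (measurability _ (RGenOpens.measurableE R)).
move=> _ [_ [a [b ->] <-]].
have /cf/open_subspaceP[V oV VD] : open (`]a, b[%classic : set R) by exact: interval_open.
rewrite setIC -VD.
by apply: measurableI => //; exact: open_measurable_rV.
Qed.

End rV_measurability.

(** Balls of the sup norm are cubes of side [e *+ 2]. Each is the product of an interval and a cube
    of one dimension less, so the volume follows by induction, starting from the point mass in
    dimension 0. *)
Lemma lebesgue_rV_ball (R : realType) (n : nat) (x : 'rV[R]_n) (e : R) :
  0 < e -> lebesgue_rV R n (ball x e) = ((e *+ 2) ^+ n)%:E.
Proof.
move=> e0; elim: n x => [|n IH] x.
  by rewrite /= diracE mem_set ?expr0//; split => // i [].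
rewrite /= /lebesgue_rV_step /pushforward.
have -> : @rV_cons R n @^-1` ball x e =
    ball (x ord0 ord0) e `*` ball (\row_j x ord0 (lift ord0 j)) e.
  have c0 z : (rV_cons z : 'rV[R]_n.+1) ord0 ord0 = z.1.
    rewrite (_ : ord0 = lshift n ord0 :> 'I_(1 + n)); last exact: val_inj.
    by rewrite /rV_cons (@row_mxEl _ 1 1 n) mxE mulr1n.
  have cS z j : (rV_cons z : 'rV[R]_n.+1) ord0 (lift ord0 j) = z.2 ord0 j.
    rewrite (_ : lift ord0 j = rshift 1 j :> 'I_(1 + n)); last exact: val_inj.
    by rewrite /rV_cons (@row_mxEr _ 1 1 n).
  apply/seteqP; split => z /=.
    move=> [_ xz]; split => /=; first by rewrite -c0; exact: xz.
    by split => // i j; rewrite mxE (ord1 i) -cS; exact: xz.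
  move=> [/= xz [_ xz']]; split => // i j; rewrite (ord1 i).
  case: (unliftP ord0 j) => [k ->|->]; last by rewrite c0.
  by rewrite cS; have := xz' ord0 k; rewrite mxE.
rewrite product_measure1E; [|exact: measurable_ball|exact: measurable_ball_rV].
by rewrite IH exprS EFinM; congr (_ * _)%E; exact/lebesgue_measure_ball/ltW.
Qed.

(** * The Euclidean norm compared with the sup norm *)

Section euclidean_norm.
Context (R : realType) (n : nat).
Implicit Types (x y : 'rV[R]_n) (C : set 'rV[R]_n).

Lemma norm2_le_norm x : norm2 x <= Num.sqrt n%:R * `|x|.
Proof.
rewrite -[`|x|]ger0_norm// -sqrtr_sqr -sqrtrM ?ler0n// ler_wsqrtr//.
have xi (i : 'I_n) : x ord0 i ^+ 2 <= `|x| ^+ 2.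
  rewrite -(real_normK (num_real (x ord0 i))) lerXn2r ?nnegrE//.
  rewrite [leRHS]mx_normrE.
  exact: (le_bigmax _ (fun ij => `|x ij.1 ij.2|) (ord0, i)).
apply: le_trans (ler_sum _ (fun i _ => xi i)) _.
by rewrite sumr_const card_ord mulr_natl.
Qed.

(** Boundedness ensures that the [sup] defining the diameter is a true upper bound and not a default
    value. *)
Lemma norm2_le_diam2 C x y : bounded_set C -> C x -> C y ->
  norm2 (x - y) <= diam2 C.
Proof.
(* [bounded_set] bounds the norm by every constant strictly above [M'], hence the shift by 1. *)
move=> [M' [_ /(_ (M' + 1))]]; rewrite ltrDl ltr01 => /(_ isT).
set M := M' + 1 => CM Cx Cy; apply: ub_le_sup; last first.
  by exists x => //; exists y.
exists (Num.sqrt n%:R * (M + M)) => _ [a Ca [b Cb <-]].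
apply: le_trans (norm2_le_norm _) _; rewrite ler_wpM2l ?sqrtr_ge0//.
by apply: le_trans (ler_normB _ _) _; apply: lerD; exact: CM.
Qed.

Lemma lipschitz2_within_continuous C (K : R) (f : 'rV[R]_n -> R) :
  lipschitz2 C K f -> {within C, continuous f}.
Proof.
move=> Kf; apply/subspace_continuousP => x Cx.
(* The absolute value covers a negative [K], and adding 1 makes [M] positive, so that [e / M] is a
   valid radius. *)
pose M := `|K| * Num.sqrt n%:R + 1.
have M0 : 0 < M by rewrite ltr_wpDl// mulr_ge0// sqrtr_ge0.
have fM y : C y -> `|f x - f y| <= M * `|x - y|.
  move=> Cy; apply: le_trans (Kf _ _ Cx Cy) _.
  apply: le_trans (ler_wpM2r (sqrtr_ge0 _) (ler_norm K)) _.
  apply: le_trans (ler_wpM2l (normr_ge0 K) (norm2_le_norm _)) _.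
  by rewrite mulrA ler_wpM2r// lerDl.
apply/cvgrPdist_lt => e e0; apply/nbhs_ballP; exists (e / M) => /=.
  by rewrite divr_gt0.
move=> y; rewrite mx_norm_ball /ball_/= ltr_pdivlMr// mulrC => xy Cy.
exact: le_lt_trans (fM y Cy) xy.
Qed.

End euclidean_norm.

(** * Probability measures given by densities *)

Section densities.
Context d (T : measurableType d) (R : realType) (mu : {measure set T -> \bar R}).
Context (C : set T) (mC : measurable C).

(** Extended by zero outside [C], the density is nonnegative and measurable on all of [T], so its
    indefinite integral is a measure. *)
Lemma probability_of_density (g : T -> \bar R) :
  measurable_fun C g -> (forall x, C x -> (0 <= g x)%E) ->
  (\int[mu]_(x in C) g x = 1)%E ->
  exists P : probability T R, forall S, measurable S ->
    P S = (\int[mu]_(x in S `&` C) g x)%E.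
Proof.
move=> mg g0 g1; pose m S := (\int[mu]_(x in S) (g \_ C) x)%E.
have gC0 x : (0 <= (g \_ C) x)%E by exact: erestrict_ge0.
have m0 : m set0 = 0%E by rewrite /m integral_set0.
have m_ge0 S : (0 <= m S)%E by exact: integral_ge0.
have m_add : semi_sigma_additive m.
  by apply: semi_sigma_additive_nng_induced => //; exact/(measurable_restrictT _ mC).
have m1 : m setT = 1%E by rewrite /m -integral_mkcondr setTI.
pose isM := isMeasure.Build _ _ _ m m0 m_ge0 m_add.
pose M : {measure set T -> \bar R} := HB.pack m isM.
pose isP := Measure_isProbability.Build _ _ _ M m1.
pose P : probability T R := HB.pack m isM isP.
by exists P => S mS; rewrite integral_mkcondr.
Qed.

(* Integrating the pointwise hypothesis in the variable y gives
   c * f x <= K * (c' * f' x), because c * f and c' * f' both integrate to 1. *)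
Lemma density_ratio_le (f f' : T -> R) (c c' K : R) (P P' : probability T R) :
  measurable_fun C f -> measurable_fun C f' ->
  (forall x, C x -> 0 <= f x) -> (forall x, C x -> 0 <= f' x) ->
  0 < c -> 0 < c' -> 0 <= K ->
  (forall S, measurable S -> P S = \int[mu]_(x in S `&` C) (c * f x)%:E)%E ->
  (forall S, measurable S -> P' S = \int[mu]_(x in S `&` C) (c' * f' x)%:E)%E ->
  (forall x y, C x -> C y -> f x * f' y <= K * (f' x * f y)) ->
  forall S, measurable S -> (P S <= K%:E * P' S)%E.
Proof.
move=> mf mf' f0 f'0 c0 c'0 K0 PE P'E ff' S mS.
have g0 x : C x -> 0 <= c * f x by move=> /f0; exact/mulr_ge0/ltW.
have g'0 x : C x -> 0 <= c' * f' x by move=> /f'0; exact/mulr_ge0/ltW.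
have mg : measurable_fun C (fun x => (c * f x)%:E).
  by apply/measurable_EFinP; exact: measurable_funM.
have mg' : measurable_fun C (fun x => (c' * f' x)%:E).
  by apply/measurable_EFinP; exact: measurable_funM.
have P1 : (\int[mu]_(x in C) (c * f x)%:E = 1)%E.
  by rewrite -(setTI C) -PE// probability_setT.
have P'1 : (\int[mu]_(x in C) (c' * f' x)%:E = 1)%E.
  by rewrite -(setTI C) -P'E// probability_setT.
have intg k : 0 <= k -> (\int[mu]_(y in C) (k%:E * (c * f y)%:E) = k%:E)%E.
  by move=> k0; rewrite ge0_integralZl ?lee_fin ?P1 ?mule1.
have intg' k : 0 <= k -> (\int[mu]_(y in C) (k%:E * (c' * f' y)%:E) = k%:E)%E.
  by move=> k0; rewrite ge0_integralZl ?lee_fin ?P'1 ?mule1.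
have gg' x : C x -> c * f x <= K * (c' * f' x).
  move=> Cx; have Kg0 : 0 <= K * (c' * f' x) by rewrite mulr_ge0// g'0.
  (* The masses are inserted crosswise: that of [c' * f'] on the left, that of [c * f] on the right.
     The integrands in [y] then compare by [ff'] scaled by [c * c']. *)
  rewrite -lee_fin -(intg' _ (g0 x Cx)) -(intg _ Kg0).
  apply: ge0_le_integral => // [y Cy|||y Cy].
  - by rewrite -EFinM lee_fin mulr_ge0 ?g0 ?g'0.
  - exact: measurable_funeM.
  - exact: measurable_funeM.
  - rewrite -!EFinM lee_fin.
    have := ler_wpM2l (ltW (mulr_gt0 c0 c'0)) (ff' x y Cx Cy).
    by congr (_ <= _); ring.
have SC : S `&` C `<=` C by exact: subIsetr.
have mSC : measurable (S `&` C) by exact: measurableI.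
rewrite PE// P'E// -ge0_integralZl ?lee_fin//; last 2 first.
- exact: measurable_funS mg'.
- by move=> x [_ Cx]; rewrite lee_fin g'0.
apply: ge0_le_integral => //.
- by move=> x [_ Cx]; rewrite lee_fin g0.
- exact: measurable_funS mg.
- by apply: measurable_funeM; exact: measurable_funS mg'.
- by move=> x [_ Cx]; rewrite -EFinM lee_fin gg'.
Qed.

End densities.

(** * Volumes of bodies and normalization of densities *)

Section lebesgue_of_bodies.
Context (R : realType) (n : nat).
Implicit Types C : set 'rV[R]_n.

Lemma lebesgue_rV_bounded_lty C : measurable C -> bounded_set C ->
  (lebesgue_rV R n C < +oo)%E.
Proof.
move=> mC [M [_ /(_ (`|M| + 1))]].
rewrite (le_lt_trans (ler_norm M)) ?ltrDl// => /(_ isT) CM.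
(* The norm is at most [|M| + 1] on [C]; the radius [|M| + 2] leaves room for the strict inequality
   of an open ball. *)
have M0 : 0 < `|M| + 2 by rewrite ltr_wpDl.
apply: (@le_lt_trans _ _ (lebesgue_rV R n (ball 0 (`|M| + 2)))).
  apply: le_measure; rewrite ?inE//; first exact: measurable_ball_rV.
  move=> x /CM xM; rewrite mx_norm_ball /ball_/= sub0r normrN.
  by apply: le_lt_trans xM _; rewrite ltrD2l ltr1n.
by rewrite lebesgue_rV_ball// ltry.
Qed.

Lemma lebesgue_rV_interior_gt0 C : measurable C -> C° !=set0 ->
  (0 < lebesgue_rV R n C)%E.
Proof.
move=> mC [x /nbhs_ballP[r/= r0 rC]].
apply: (@lt_le_trans _ _ (lebesgue_rV R n (ball x r))).
  by rewrite lebesgue_rV_ball// lte_fin exprn_gt0// mulrn_wgt0.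
by apply: le_measure; rewrite ?inE//; exact: measurable_ball_rV.
Qed.

(** The volume of [C] is positive, by its interior, and finite, by boundedness. The bounds [a] and
    [b] then make the integral of [f] positive and finite, so its inverse is the normalizing
    constant. *)
Lemma density_proportional_to_exists C (f : 'rV[R]_n -> R) (a b : R) :
  measurable C -> bounded_set C -> C° !=set0 -> measurable_fun C f ->
  0 < a -> (forall x, C x -> a <= f x <= b) ->
  exists P : probability 'rV[R]_n R, density_proportional_to C f P.
Proof.
move=> mC bC iC mf a0 fab; pose mu := lebesgue_rV R n.
have f0 x : C x -> (0 <= (f x)%:E)%E.
  by move=> /fab/andP[+ _]; rewrite lee_fin; exact/le_trans/ltW.
have mfE : measurable_fun C (fun x => (f x)%:E) by exact/measurable_EFinP.
pose Z := (\int[mu]_(x in C) (f x)%:E)%E.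
have Z_gt0 : (0 < Z)%E.
  apply: (@lt_le_trans _ _ (a%:E * mu C)%E).
    by rewrite mule_gt0 ?lte_fin//; exact: lebesgue_rV_interior_gt0.
  rewrite -integral_cst//; apply: ge0_le_integral => //.
  - by move=> x _; rewrite lee_fin ltW.
  - by move=> x /fab/andP[]; rewrite lee_fin.
have Z_lty : (Z < +oo)%E.
  apply: (@le_lt_trans _ _ (b%:E * mu C)%E).
    rewrite -integral_cst//; apply: ge0_le_integral => //.
    by move=> x /fab/andP[]; rewrite lee_fin.
  apply: lte_mul_pinfty => //; last exact: lebesgue_rV_bounded_lty.
  (* The sign of [b] comes from a point of [C], where [0 < a <= f x <= b]. *)
  have [x /interior_subset /fab/andP[ax xb]] := iC.
  by rewrite lee_fin (le_trans (ltW a0))// (le_trans ax).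
have ZE : Z = (fine Z)%:E by rewrite fineK// ge0_fin_numE// ltW.
have z0 : 0 < fine Z by rewrite fine_gt0// Z_gt0.
have [P PE] : exists P : probability 'rV[R]_n R, forall S, measurable S ->
    P S = (\int[mu]_(x in S `&` C) ((fine Z)^-1 * f x)%:E)%E.
  apply: probability_of_density => //.
  - by apply/measurable_EFinP; exact: measurable_funM.
  - by move=> x Cx; rewrite EFinM mule_ge0 ?f0// lee_fin invr_ge0 ltW.
  - under eq_integral do rewrite EFinM.
    rewrite ge0_integralZl// ?lee_fin ?invr_ge0 ?(ltW z0)//.
    by rewrite -/Z {2}ZE -EFinM mulVf// gt_eqF.
by exists P; exists (fine Z)^-1; rewrite ?invr_gt0.
Qed.

End lebesgue_of_bodies.

(** * Variation of the empirical loss over the body and between neighbors *)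

Section empirical_loss.
Context (R : realType) (p n : nat) (X : Type).
Context (C : set 'rV[R]_p) (l : 'rV[R]_p -> X -> R) (L : R).
Hypothesis l_lipschitz : forall d : X, lipschitz2 C L (fun theta => l theta d).

(** Serves twice: for the measurability of the unnormalized density and for its two-sided bounds on
    [C]. *)
Lemma empirical_loss_lipschitz2 (D : n.-tuple X) :
  lipschitz2 C (n%:R * L) (fun theta => empirical_loss l theta D).
Proof.
move=> x y Cx Cy; rewrite /empirical_loss -sumrB.
apply: le_trans (ler_norm_sum _ _ _) _.
apply: le_trans (ler_sum _ (fun i _ => l_lipschitz (tnth D i) Cx Cy)) _.
by rewrite sumr_const card_ord -mulrA mulr_natl.
Qed.

(** All summands cancel except those of the entry that changes. *)
Lemma neighbors_empirical_lossB (D D' : n.-tuple X) (x y : 'rV[R]_p) :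
  bounded_set C -> 0 <= L -> C x -> C y -> neighbors D D' ->
  (empirical_loss l y D - empirical_loss l y D') -
  (empirical_loss l x D - empirical_loss l x D') <= 2 * L * diam2 C.
Proof.
move=> bC L0 Cx Cy [i [_ DD']].
have lossB z : empirical_loss l z D - empirical_loss l z D' =
    l z (tnth D i) - l z (tnth D' i).
  rewrite /empirical_loss (bigD1 i)//= [X in _ - X](bigD1 i)//=.
  rewrite (eq_bigr (fun j => l z (tnth D' j))) => [|j ji]; first by ring.
  by rewrite DD'.
(* The four remaining terms are regrouped by entry instead of by point; the old and the new entry
   each contribute one [L * diam2 C]. *)
have lB d : `|l y d - l x d| <= L * diam2 C.
  apply: le_trans (l_lipschitz d Cy Cx) _.
  by rewrite ler_wpM2l// norm2_le_diam2.
rewrite !lossB.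
have := ler_normlP _ _ (lB (tnth D i)); have := ler_normlP _ _ (lB (tnth D' i)).
by move=> [? _] [_ ?]; lra.
Qed.

End empirical_loss.

(** * Existence and privacy of exponential sampling *)

Theorem theorem3p1 (R : realType) (p n : nat) (X : Type)
    (C : set 'rV[R]_p) (l : 'rV[R]_p -> X -> R) (L eps : R)
    (p_gt0 : (0 < p)%N)
    (C_closed : closed C) (C_bounded : bounded_set C) (C_convex : convex_set C)
    (C_interior : C° !=set0)
    (L_gt0 : 0 < L)
    (l_convex : forall d : X, convex_function C (fun theta => l theta d))
    (l_lipschitz : forall d : X, lipschitz2 C L (fun theta => l theta d))
    (eps_gt0 : 0 < eps) :
  (exists A : n.-tuple X -> probability 'rV[R]_p R, is_exp_samp C l L eps A) /\
  (forall A : n.-tuple X -> probability 'rV[R]_p R,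
     is_exp_samp C l L eps A -> differentially_private eps A).
Proof.
have mC : measurable C by exact: closed_measurable_rV.
have [x0 Cx0] : C !=set0 by case: C_interior => x /interior_subset; exists x.
pose k := eps / (2 * L * diam2 C).
pose f (D : n.-tuple X) theta := expR (- k * empirical_loss l theta D).
have mf D : measurable_fun C (f D).
  apply: measurableT_comp => //; apply: measurable_funM => //.
  apply: within_continuous_measurable_rV => //.
  exact/lipschitz2_within_continuous/empirical_loss_lipschitz2.
have diam0 : 0 <= diam2 C.
  exact: le_trans (sqrtr_ge0 _) (norm2_le_diam2 C_bounded Cx0 Cx0).
have den0 : 0 <= 2 * L * diam2 C by rewrite !mulr_ge0// ltW.
have k0 : 0 <= k by rewrite divr_ge0// ltW.
(* This is an equality when the denominator is nonzero; otherwise the left side is 0. The inequality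
   covers both cases. *)
have k_le : k * (2 * L * diam2 C) <= eps.
  have [->|den_neq0] := eqVneq (2 * L * diam2 C) 0; first by rewrite mulr0 ltW.
  by rewrite divfK.
split=> [|A A_samp D D' DD' S mS].
  suff fP D : exists P, density_proportional_to C (f D) P.
    by have [A AP] := choice fP; exists A.
  (* On [C] the loss stays within [r] of its value at the reference point [x0], which confines the
     density between two positive constants. *)
  pose r := n%:R * L * diam2 C; pose l0 := empirical_loss l x0 D.
  apply: (density_proportional_to_exists (a := expR (- k * (l0 + r)))
    (b := expR (- k * (l0 - r)))) => // [|x Cx]; first exact: expR_gt0.
  have : `|empirical_loss l x D - l0| <= r.
    apply: le_trans (empirical_loss_lipschitz2 l_lipschitz D Cx Cx0) _.
    by rewrite ler_wpM2l ?norm2_le_diam2// mulr_ge0// ltW.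
  rewrite ler_distl => /andP[l0x xl0].
  by rewrite /f !ler_expR !mulNr !lerN2 !ler_wpM2l// -lerBlDr.
have [c c0 PE] := A_samp D; have [c' c'0 P'E] := A_samp D'.
apply: (density_ratio_le mC (mf D) (mf D') _ _ c0 c'0 _ PE P'E) => //.
- by move=> *; exact: expR_ge0.
- by move=> *; exact: expR_ge0.
(* Between exponents, the cross-multiplied inequality says that [k] times the oscillation of the
   loss difference from [x] to [y] is at most [eps]. *)
move=> x y Cx Cy; rewrite /f -!expRD ler_expR.
have := neighbors_empirical_lossB l_lipschitz C_bounded (ltW L_gt0) Cx Cy DD'.
by move=> /(ler_wpM2l k0) /le_trans /(_ k_le); lra.
Qed.
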